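(* Let $(E,\langle\cdot,\cdot\rangle,\Theta)$ be a pre-Courant algebroid, let $\mathcal{S}_1,\mathcal{S}_2,\mathcal{S}_3$ be endomorphisms of $E$ and let $i,j\in\{1,2,3\}$. The following assertions are equivalent: (i) $(\mathcal{S}_1,\mathcal{S}_2,\mathcal{S}_3)$ is a hypersymplectic (resp., para-hypersymplectic) structure on $(E,\Theta)$; (ii) $(\mathcal{S}_1,\mathcal{S}_2,\mathcal{S}_3)$ is a hypersymplectic (resp., para-hypersymplectic) structure on $(E,\Theta_{\mathcal{S}_i})$; (iii) $(\mathcal{S}_1,\mathcal{S}_2,\mathcal{S}_3)$ is a hypersymplectic (resp., para-hypersymplectic) structure on $(E,\Theta_{\mathcal{T}_j})$, where $\mathcal{T}_j=\varepsilon_{j-1}\mathcal{S}_{j-1}\mathcal{S}_{j+1}$ (indices in $\mathbb{Z}_3$).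
   Context: Let $E\to M$ be a real vector bundle over a smooth manifold with a fibrewise non-degenerate symmetric bilinear form $\langle\cdot,\cdot\rangle$. A pre-Courant structure $\Theta$ on $(E,\langle\cdot,\cdot\rangle)$ is a pair $(\rho,[\cdot,\cdot])$, where $\rho:E\to TM$ is a vector bundle morphism (anchor) and $[\cdot,\cdot]:\Gamma(E)\times\Gamma(E)\to\Gamma(E)$ is an $\mathbb{R}$-bilinear (not necessarily skew-symmetric) bracket with $\rho(X)\cdot\langle Y,Z\rangle=\langle[X,Y],Z\rangle+\langle Y,[X,Z]\rangle$ and $\rho(X)\cdot\langle Y,Z\rangle=\langle X,[Y,Z]+[Z,Y]\rangle$ for all $X,Y,Z\in\Gamma(E)$. Endomorphisms of $E$ are vector bundle morphisms over $\mathrm{id}_M$; juxtaposition is composition; $\mathcal{I}$ is skew-symmetric if $\langle\mathcal{I}u,v\rangle=-\langle u,\mathcal{I}v\rangle$. The deformation of $\Theta=(\rho,[\cdot,\cdot])$ by $\mathcal{I}$ is $\Theta_{\mathcal{I}}=(\rho\circ\mathcal{I},[\cdot,\cdot]_{\mathcal{I}})$, $[X,Y]_{\mathcal{I}}=[\mathcal{I}X,Y]+[X,\mathcal{I}Y]-\mathcal{I}[X,Y]$ (again a pre-Courant structure if $\mathcal{I}$ is skew-symmetric), and $\Theta_{\mathcal{I},\mathcal{J}}=(\Theta_{\mathcal{I}})_{\mathcal{J}}$; $c\,\Theta=(c\rho,c[\cdot,\cdot])$ for $c\in\mathbb{R}$. For $\boldsymbol{\varepsilon}=(\varepsilon_1,\varepsilon_2,\varepsilon_3)$,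 $\varepsilon_i=\pm1$, an $\boldsymbol{\varepsilon}$-hypersymplectic structure on $(E,\Theta)$ is a triplet $(\mathcal{S}_1,\mathcal{S}_2,\mathcal{S}_3)$ of skew-symmetric endomorphisms of $E$ such that (i) $\mathcal{S}_i^2=\varepsilon_i\,\mathrm{id}_E$; (ii) $\mathcal{S}_i\mathcal{S}_j=\varepsilon_1\varepsilon_2\varepsilon_3\,\mathcal{S}_j\mathcal{S}_i$ for $i\ne j$; (iii) $\Theta_{\mathcal{S}_i,\mathcal{S}_i}=\varepsilon_i\Theta$, for $i,j\in\{1,2,3\}$. It is called hypersymplectic if $\varepsilon_1=\varepsilon_2=\varepsilon_3=-1$, and para-hypersymplectic if $\varepsilon_1\varepsilon_2\varepsilon_3=-1$ with not all $\varepsilon_i$ equal to $-1$; by convention (after a cyclic permutation of indices) para-hypersymplectic structures have $\varepsilon_1=\varepsilon_2=1$, $\varepsilon_3=-1$. In the definition of $\mathcal{T}_j$ the signs are those of the case considered. (When the $\mathcal{S}_i$ satisfy the algebraic conditions of the definition, $\mathcal{S}_i$ and $\mathcal{T}_j$ are skew-symmetric, so $\Theta_{\mathcal{S}_i}$ and $\Theta_{\mathcal{T}_j}$ are pre-Courant structures.) Indices are taken in $\mathbb{Z}_3=\{1,2,3\}$. *)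

(* Defs.v *)
From HB Require Import structures.
From mathcomp Require Import all_boot all_order all_algebra.
From mathcomp Require Import all_classical all_reals all_analysis.

Set Implicit Arguments.
Unset Strict Implicit.
Unset Printing Implicit Defensive.
Import Order.TTheory GRing.Theory Num.Theory.
Import numFieldNormedType.Exports.

Local Open Scope classical_set_scope.
Local Open Scope ring_scope.

(* Meaningful when [A] is open: [Ck k.+1 A f] says that [f] is Fréchet
   differentiable at every point of [A] and that all its directional
   derivatives are of class C^k on [A]. *)
Fixpoint Ck (R : realType) (n k : nat) (A : set 'rV[R]_n) (f : 'rV[R]_n -> R) :
    Prop :=
  if k is k'.+1 then
    (forall x, A x -> differentiable f x) /\
    (forall v, Ck k' A (fun x => 'd f x v))
  else forall x, A x -> {for x, continuous f}.

Definition smooth_on (R : realType) (n : nat) (A : set 'rV[R]_n)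
    (f : 'rV[R]_n -> R) : Prop :=
  forall k, Ck k A f.

Definition smooth_map_on (R : realType) (m n : nat) (A : set 'rV[R]_m)
    (f : 'rV[R]_m -> 'rV[R]_n) : Prop :=
  forall i, smooth_on A (fun x => f x 0 i).

Section Calculus.
Context (R : realType).

Lemma diff_near_eq (V W : normedModType R) (f g : V -> W) (x : V) :
  (\near x, f x = g x) -> differentiable f x ->
  differentiable g x /\ 'd g x = 'd f x :> (V -> W).
Proof.
move=> fg df.
have gE : g \o shift x = cst (g x) + 'd f x +o_ 0 id.
  apply/eqaddoP => e e0.
  have /eqaddoP/(_ e e0) := diff_locally df.
  apply: filterS2 (_ : \forall y \near 0, f (y + x) = g (y + x)); last first.
    move: fg; rewrite (near_shift 0 x) => fg0.
    by apply: filterS fg0 => y /=; rewrite subr0.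
  by move=> y /= fgy; rewrite !fctE /= fgy (nbhs_singleton fg).
have dg : 'd g x = 'd f x :> (V -> W).
  by apply: diff_unique gE; exact: diff_continuous.
split=> //; apply/diff_locallyP; rewrite dg; split=> //.
exact: diff_continuous.
Qed.

Lemma row_diff_basis n (W : normedModType R) (f : {linear 'rV[R]_n -> W}) v :
  f v = \sum_j v 0 j *: f (delta_mx 0 j).
Proof.
by rewrite {1}[v]row_sum_delta raddf_sum; apply: eq_bigr => j _; exact: linearZ_LR.
Qed.

Lemma differentiable_row (V : normedModType R) n (f : V -> 'rV[R]_n) x :
  (forall i, differentiable (fun y => f y 0 i) x) -> differentiable f x.
Proof.
move=> df.
have -> : f = \sum_(j < n) (fun y => f y 0 j *: (delta_mx 0 j : 'rV[R]_n)).
  by apply/funext => y; rewrite fct_sumE [LHS]row_sum_delta.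
by apply: differentiable_sum => j; exact: differentiableZl.
Qed.

Lemma diff_near_eqE (V W : normedModType R) (f g : V -> W) (x v : V) :
  (\near x, f x = g x) -> differentiable f x -> 'd g x v = 'd f x v.
Proof. by move=> fg df; have [_ ->] := diff_near_eq fg df. Qed.

Lemma diff_compE (U V W : normedModType R) (f : U -> V) (g : V -> W) x y v :
  f x = y -> differentiable f x -> differentiable g y ->
  'd (g \o f) x v = 'd g y ('d f x v).
Proof. by move=> <- df dg; rewrite (diff_comp df dg). Qed.

Lemma diff_row_coord (V : normedModType R) n (f : V -> 'rV[R]_n) x v i :
  differentiable f x -> 'd f x v 0 i = 'd (fun y => f y 0 i) x v.
Proof.
move=> df.
pose p (N : 'rV[R]_n) : R := N 0 i.
have lp : linear p by move=> a y z; rewrite /p !mxE.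
pose pM := GRing.isLinear.Build _ _ _ _ _ lp.
pose pL : {linear 'rV[R]_n -> R} := HB.pack p pM.
have pc : continuous pL by exact: coord_continuous.
have dp : differentiable pL (f x) by exact: linear_differentiable.
apply: esym; apply: etrans (diff_compE v erefl df dp) _.
by have /(congr1 (@^~ ('d f x v))) /= -> := diff_lin (f x) pc.
Qed.

Variable n : nat.
Implicit Types (A : set 'rV[R]_n) (f g : 'rV[R]_n -> R).

Lemma Ck_eq k A f g : open A -> (forall x, A x -> f x = g x) ->
  Ck k A f -> Ck k A g.
Proof.
move=> oA; elim: k f g => [|k IH] f g fg /=.
  move=> cf x Ax; have nfg : \near x, f x = g x.
    by apply: filterS (open_nbhs_nbhs (conj oA Ax)) => y; exact: fg.
  rewrite /prop_for /continuous_at -(fg x Ax); apply: cvg_trans (cf x Ax).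
  exact: (near_eq_cvg nfg).
have nfg x : A x -> \near x, f x = g x.
  by move=> Ax; apply: filterS (open_nbhs_nbhs (conj oA Ax)) => y; exact: fg.
move=> [df Df]; split=> [x Ax|v].
  by have [] := diff_near_eq (nfg _ Ax) (df x Ax).
apply: IH (Df v) => x Ax.
exact: esym (diff_near_eqE v (nfg _ Ax) (df x Ax)).
Qed.

Lemma Ck_sub k A B f : A `<=` B -> Ck k B f -> Ck k A f.
Proof.
move=> AB; elim: k f => [|k IH] f /=; first by move=> cf x /AB; exact: cf.
by move=> [df Df]; split=> [x /AB|v]; [exact: df | exact: IH].
Qed.

Lemma CkW k A f : Ck k.+1 A f -> Ck k A f.
Proof.
elim: k f => [|k IH] f [df Df].
  by move=> x Ax; apply: differentiable_continuous; exact: df.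
by split=> // v; apply: IH; exact: Df.
Qed.

Lemma Ck_cst k A c : Ck k A (fun=> c).
Proof.
elim: k c => [|k IH] c; first by move=> x _; exact: cst_continuous.
split=> [x _|v]; first exact: differentiable_cst.
have -> : (fun x : 'rV[R]_n => 'd (fun=> c) x v) = (fun=> 0).
  by apply/funext => x; rewrite (diff_cst c x).
exact: IH.
Qed.

Lemma CkD k A f g : open A -> Ck k A f -> Ck k A g ->
  Ck k A (fun x => f x + g x).
Proof.
move=> oA; elim: k f g => [|k IH] f g.
  by move=> cf cg x Ax; apply: continuousD; [exact: cf|exact: cg].
move=> [df Df] [dg Dg]; split=> [x Ax|v].
  by apply: differentiableD; [exact: df|exact: dg].
apply: Ck_eq (IH _ _ (Df v) (Dg v)) => // x Ax.
by have /(congr1 (@^~ v)) := diffD (df x Ax) (dg x Ax).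
Qed.

Lemma CkM k A f g : open A -> Ck k A f -> Ck k A g ->
  Ck k A (fun x => f x * g x).
Proof.
move=> oA; elim: k f g => [|k IH] f g.
  by move=> cf cg x Ax; apply: continuousM; [exact: cf|exact: cg].
move=> Cf Cg; move: (CkW Cf) (CkW Cg) => cf cg.
case: Cf Cg => [df Df] [dg Dg]; split=> [x Ax|v].
  by apply: differentiableM; [exact: df|exact: dg].
apply: Ck_eq (CkD oA (IH _ _ cf (Dg v)) (IH _ _ cg (Df v))) => // x Ax.
by have /(congr1 (@^~ v)) := diffM (df x Ax) (dg x Ax).
Qed.

Lemma Ck_sum k A I (r : seq I) (f : I -> 'rV[R]_n -> R) : open A ->
  (forall i, Ck k A (f i)) -> Ck k A (fun x => \sum_(i <- r) f i x).
Proof.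
move=> oA Cf; elim: r => [|i r IH].
  have -> : (fun x => \sum_(i <- [::]) f i x) = fun=> 0.
    by apply/funext => x; rewrite big_nil.
  exact: Ck_cst.
have -> : (fun x => \sum_(i <- i :: r) f i x) =
    fun x => f i x + \sum_(j <- r) f j x.
  by apply/funext => x; rewrite big_cons.
exact: CkD.
Qed.

End Calculus.

Lemma Ck_comp (R : realType) m n k (A : set 'rV[R]_m) (B : set 'rV[R]_n)
    (h : 'rV[R]_m -> 'rV[R]_n) (f : 'rV[R]_n -> R) :
  open A -> (forall x, A x -> B (h x)) ->
  (forall i, Ck k A (fun x => h x 0 i)) -> Ck k B f ->
  Ck k A (f \o h).
Proof.
move=> oA AB; elim: k f => [|k IH] f.
  move=> ch cf x Ax.
  apply: continuous_comp; last exact/cf/AB.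
  have -> : h = \sum_(j < n) (fun y => h y 0 j *: (delta_mx 0 j : 'rV[R]_n)).
    by apply/funext => y; rewrite fct_sumE [LHS]row_sum_delta.
  elim/big_ind : _ => [|u v cu cv|i _]; first exact: cst_continuous.
    exact: continuousD.
  by apply: continuousZr_tmp; exact: ch.
move=> Ch [df Df].
have dh x : A x -> differentiable h x.
  by move=> Ax; apply: differentiable_row => i; case: (Ch i) => + _; exact.
have cf := IH f (fun i => CkW (Ch i)).
split=> [x Ax|v].
  by apply: differentiable_comp; [exact: dh|exact/df/AB].
have C : Ck k A (fun x => \sum_(j < n)
    'd (fun y => h y 0 j) x v * ('d f (h x) (delta_mx 0 j))).
  apply: Ck_sum => // j; apply: CkM => //; first by case: (Ch j) => _; exact.
  have Df' := Df (delta_mx 0 j).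
  by apply: (IH (fun y => 'd f y (delta_mx 0 j)) _ Df') => i; exact: CkW.
apply: Ck_eq C => // x Ax.
apply: esym; apply: etrans (diff_compE v erefl (dh x Ax) (df _ (AB x Ax))) _.
apply: etrans (row_diff_basis _ _) _; apply: eq_bigr => j _.
by rewrite (diff_row_coord _ _ (dh x Ax)).
Qed.

Lemma Ck_pointwise (R : realType) n k (A : set 'rV[R]_n) (f : 'rV[R]_n -> R) :
  (forall x, A x -> Ck k [set x] f) -> Ck k A f.
Proof.
elim: k f => [|k IH] f Cf /=; first by move=> x /Cf; apply.
split=> [x /Cf[+ _]|v]; first exact.
by apply: IH => x /Cf[_]; exact.
Qed.

Record manifold (R : realType) := Manifold {
  points :> topologicalType;
  dimension : nat;
  chart : Type;
  chart_dom : chart -> set points;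
  chart_fun : chart -> points -> 'rV[R]_dimension;
  (* only relevant on the image of [chart_dom] under [chart_fun] *)
  chart_inv : chart -> 'rV[R]_dimension -> points;
  points_hausdorff : hausdorff_space points;
  points_second_countable : @second_countable points;
  chart_cover : forall x, exists a, chart_dom a x;
  open_chart_dom : forall a, open (chart_dom a);
  open_chart_image : forall a, open (chart_fun a @` chart_dom a);
  chart_funK : forall a x, chart_dom a x -> chart_inv a (chart_fun a x) = x;
  chart_fun_continuous :
    forall a x, chart_dom a x -> {for x, continuous (chart_fun a)};
  chart_inv_continuous : forall a x,
    chart_dom a x -> {for chart_fun a x, continuous (chart_inv a)};
  chart_transition_smooth : forall a b,
    smooth_map_on (chart_fun a @` (chart_dom a `&` chart_dom b))
      (chart_fun b \o chart_inv a) }.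

Definition smooth_fun_on (R : realType) (M : manifold R) (W : set M)
    (f : M -> R) : Prop :=
  forall a : chart M,
    smooth_on (chart_fun a @` (chart_dom a `&` W)) (f \o chart_inv a).

Definition smooth_row_on (R : realType) (M : manifold R) (W : set M) (n : nat)
    (f : M -> 'rV[R]_n) : Prop :=
  forall i, smooth_fun_on W (fun x => f x 0 i).

Section ManifoldTheory.
Context (R : realType) (M : manifold R).
Implicit Types (W : set M) (f g : M -> R) (a b c : chart M).

Lemma open_chart_sub a W : open W -> open (chart_fun a @` (chart_dom a `&` W)).
Proof.
move=> oW; rewrite openE => _ [x [ax Wx] <-]; rewrite /interior.
have imx : nbhs (chart_fun a x) (chart_fun a @` chart_dom a).
  by apply: open_nbhs_nbhs; split; [exact: open_chart_image|exists x].
have Wnx : nbhs (chart_fun a x) (chart_inv a @^-1` W).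
  apply: chart_inv_continuous => //; rewrite chart_funK //.
  exact: open_nbhs_nbhs.
apply: filterS2 imx Wnx => _ [z az <-] /=; rewrite chart_funK // => Wz.
by exists z.
Qed.

Lemma smooth_fun_eq W f g : open W -> (forall x, W x -> f x = g x) ->
  smooth_fun_on W f -> smooth_fun_on W g.
Proof.
move=> oW fg sf a k; apply: Ck_eq (sf a k); first exact: open_chart_sub.
by move=> _ [x [ax Wx] <-] /=; rewrite chart_funK //; exact: fg.
Qed.

Lemma smooth_fun_sub W W' f : W `<=` W' ->
  smooth_fun_on W' f -> smooth_fun_on W f.
Proof.
move=> sW sf a k; apply: Ck_sub (sf a k) => _ [x [ax Wx] <-].
by exists x => //; split=> //; exact: sW.
Qed.

Lemma smooth_fun_cst W (r : R) : smooth_fun_on W (fun=> r).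
Proof. by move=> a k; exact: Ck_cst. Qed.

Lemma smooth_funD W f g : open W -> smooth_fun_on W f -> smooth_fun_on W g ->
  smooth_fun_on W (fun x => f x + g x).
Proof.
by move=> oW sf sg a k; apply: CkD (sf a k) (sg a k); exact: open_chart_sub.
Qed.

Lemma smooth_funM W f g : open W -> smooth_fun_on W f -> smooth_fun_on W g ->
  smooth_fun_on W (fun x => f x * g x).
Proof.
by move=> oW sf sg a k; apply: CkM (sf a k) (sg a k); exact: open_chart_sub.
Qed.

Lemma smooth_fun_sum W n (f : 'I_n -> M -> R) : open W ->
  (forall i, smooth_fun_on W (f i)) ->
  smooth_fun_on W (fun x => \sum_(i < n) f i x).
Proof.
move=> oW sf a k.
by apply: (@Ck_sum _ _ _ _ _ _ (fun i y => f i (chart_inv a y)));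
  [exact: open_chart_sub|move=> i; exact: sf].
Qed.

Lemma smooth_fun_local W f :
  (forall x, W x -> exists2 U : set M, U x & smooth_fun_on (U `&` W) f) ->
  smooth_fun_on W f.
Proof.
move=> loc a k; apply: Ck_pointwise => _ [x [ax Wx] <-].
have [U Ux sf] := loc x Wx; apply: Ck_sub (sf a k) => _ ->.
by exists x.
Qed.

Lemma smooth_fun_chart a b (f : 'rV[R]_(dimension M) -> R) :
  smooth_on (chart_fun a @` (chart_dom a `&` chart_dom b)) f ->
  smooth_fun_on (chart_dom a `&` chart_dom b) (f \o chart_fun a).
Proof.
move=> sf c k.
pose B := chart_fun a @` (chart_dom a `&` chart_dom b).
have -> : (f \o chart_fun a) \o chart_inv c = f \o (chart_fun a \o chart_inv c).
  by [].
apply: (@Ck_comp _ _ _ _ _ B) (sf k).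
- by apply/open_chart_sub/openI; exact: open_chart_dom.
- by move=> _ [x [cx abx] <-] /=; rewrite chart_funK //; exists x.
- move=> i; apply: Ck_sub (chart_transition_smooth c a i k).
  by move=> _ [x [cx [ax bx]] <-]; exists x.
Qed.

Lemma transition_differentiable a b x : chart_dom a x -> chart_dom b x ->
  differentiable (chart_fun b \o chart_inv a) (chart_fun a x).
Proof.
move=> ax bx; apply: differentiable_row => i.
by have [+ _] := chart_transition_smooth a b i 1; apply; exists x.
Qed.

Lemma transition_cocycle a b c x v :
  chart_dom a x -> chart_dom b x -> chart_dom c x ->
  'd (chart_fun c \o chart_inv b) (chart_fun b x)
    ('d (chart_fun b \o chart_inv a) (chart_fun a x) v) =
  'd (chart_fun c \o chart_inv a) (chart_fun a x) v.
Proof.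
move=> ax bx cx.
have oab : open (chart_fun a @` (chart_dom a `&` chart_dom b)).
  by apply: open_chart_sub; exact: open_chart_dom.
have abx : (chart_fun a @` (chart_dom a `&` chart_dom b)) (chart_fun a x).
  by exists x.
have hx : (chart_fun b \o chart_inv a) (chart_fun a x) = chart_fun b x.
  by rewrite /= chart_funK.
have dh := transition_differentiable ax bx.
have dk := transition_differentiable bx cx.
apply: etrans (esym (diff_compE v hx dh dk)) _.
apply: esym; apply: diff_near_eqE.
  apply: filterS (open_nbhs_nbhs (conj oab abx)) => _ [z [az bz] <-].
  by rewrite /= !chart_funK.
by apply: (differentiable_comp dh _); rewrite hx.
Qed.

Lemma transition_id a x v : chart_dom a x ->
  'd (chart_fun a \o chart_inv a) (chart_fun a x) v = v.
Proof.
move=> ax.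
have oa : open (chart_fun a @` chart_dom a) by exact: open_chart_image.
have ax' : (chart_fun a @` chart_dom a) (chart_fun a x) by exists x.
apply: (@etrans _ _ ('d (@idfun 'rV[R]_(dimension M)) (chart_fun a x) v)).
  apply: diff_near_eqE => //.
  apply: filterS (open_nbhs_nbhs (conj oa ax')) => _ [z az <-].
  by rewrite /= chart_funK.
by rewrite diff_val.
Qed.

End ManifoldTheory.

(* A vector bundle over [M] is given by its fibres and by a family of local
   trivialisations [bundle_coord] over the open sets [bundle_dom], with inverses
   [bundle_frame] and smooth transition functions.  As the rank may depend on
   the trivialisation, it is only locally constant. *)
Record bundle (R : realType) (M : manifold R) := Bundle {
  fibre :> M -> lmodType R;
  trivialisation : Type;
  rank : trivialisation -> nat;
  bundle_dom : trivialisation -> set M;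
  bundle_coord : forall a x, {linear fibre x -> 'rV[R]_(rank a)};
  bundle_frame : forall a x, {linear 'rV[R]_(rank a) -> fibre x};
  bundle_cover : forall x, exists a, bundle_dom a x;
  open_bundle_dom : forall a, open (bundle_dom a);
  bundle_coordK : forall a x, bundle_dom a x ->
    cancel (bundle_coord a x) (bundle_frame a x);
  bundle_frameK : forall a x, bundle_dom a x ->
    cancel (bundle_frame a x) (bundle_coord a x);
  bundle_transition_smooth : forall a b v,
    smooth_row_on (bundle_dom a `&` bundle_dom b)
      (fun x => bundle_coord b x (bundle_frame a x v)) }.

Definition chart_at (R : realType) (M : manifold R) (x : M) : chart M :=
  projT1 (cid (chart_cover x)).

Lemma chart_atP (R : realType) (M : manifold R) (x : M) :
  chart_dom (chart_at x) x.
Proof. by rewrite /chart_at; case: cid. Qed.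

(* A tangent vector at [x] is represented by its components in the chosen chart
   [chart_at x]; its components in another chart are obtained by applying the
   differential of the change of charts. *)
Section TangentBundle.
Context (R : realType) (M : manifold R).

Definition tangent_space (x : M) : lmodType R := 'rV[R]_(dimension M).

Definition tangent_coord (a : chart M) (x : M) :
    {linear tangent_space x -> 'rV[R]_(dimension M)} :=
  'd (chart_fun a \o chart_inv (chart_at x)) (chart_fun (chart_at x) x).

Definition tangent_frame (a : chart M) (x : M) :
    {linear 'rV[R]_(dimension M) -> tangent_space x} :=
  'd (chart_fun (chart_at x) \o chart_inv a) (chart_fun a x).

Lemma tangent_coordK a x : chart_dom a x ->
  cancel (tangent_coord a x) (tangent_frame a x).
Proof.
move=> ax v; rewrite /tangent_coord /tangent_frame.
by rewrite transition_cocycle ?transition_id //; exact: chart_atP.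
Qed.

Lemma tangent_frameK a x : chart_dom a x ->
  cancel (tangent_frame a x) (tangent_coord a x).
Proof.
move=> ax v; rewrite /tangent_coord /tangent_frame.
by rewrite transition_cocycle ?transition_id //; exact: chart_atP.
Qed.

Lemma tangent_transition_smooth a b v :
  smooth_row_on (chart_dom a `&` chart_dom b)
    (fun x => tangent_coord b x (tangent_frame a x v)).
Proof.
move=> i.
pose t y := (chart_fun b \o chart_inv a) y 0 i.
have st : smooth_on (chart_fun a @` (chart_dom a `&` chart_dom b))
    (fun y => 'd t y v).
  move=> k.
  by have [_ +] := chart_transition_smooth a b i k.+1; exact.
apply: smooth_fun_eq (smooth_fun_chart st).
  by apply: openI; exact: open_chart_dom.
move=> x [ax bx] /=; rewrite /tangent_coord /tangent_frame.
rewrite transition_cocycle //; last exact: chart_atP.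
by rewrite diff_row_coord //; exact: transition_differentiable.
Qed.

Definition tangent_bundle : bundle M :=
  @Bundle R M tangent_space _ _ _ _ _ (@chart_cover R M) (@open_chart_dom R M)
    tangent_coordK tangent_frameK tangent_transition_smooth.

End TangentBundle.

Record sections (R : realType) (M : manifold R) (E : bundle M) := SmoothSection {
  section_fun :> forall x, E x;
  section_smooth : forall a, smooth_row_on (bundle_dom a)
    (fun x => bundle_coord a x (section_fun x)) }.

Arguments section_smooth {R M E}.

Section SectionsTheory.
Context (R : realType) (M : manifold R) (E : bundle M).
Implicit Types (X Y Z : sections E).

Lemma section_ext X Y : (forall x, X x = Y x) -> X = Y.
Proof.
case: X Y => [X sX] [Y sY] /= XY.
have {}XY : X = Y by apply/functional_extensionality_dep.
by subst Y; congr SmoothSection; exact: Prop_irrelevance.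
Qed.

HB.instance Definition _ := gen_eqMixin (sections E).
HB.instance Definition _ := gen_choiceMixin (sections E).

Fact section0_subproof a : smooth_row_on (bundle_dom a)
  (fun x => bundle_coord a x (0 : E x)).
Proof.
move=> i; apply: smooth_fun_eq (smooth_fun_cst _ 0).
  exact: open_bundle_dom.
by move=> x _; rewrite raddf0 mxE.
Qed.
Definition section0 : sections E := SmoothSection section0_subproof.

Fact sectionD_subproof X Y a : smooth_row_on (bundle_dom a)
  (fun x => bundle_coord a x (X x + Y x)).
Proof.
move=> i; have oa : open (bundle_dom a) by exact: open_bundle_dom.
apply: (smooth_fun_eq oa _
  (smooth_funD oa (section_smooth X a i) (section_smooth Y a i))).
by move=> x _; rewrite raddfD mxE.
Qed.
Definition sectionD X Y : sections E := SmoothSection (sectionD_subproof X Y).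

Fact sectionZ_subproof (c : R) X a : smooth_row_on (bundle_dom a)
  (fun x => bundle_coord a x (c *: X x)).
Proof.
move=> i; have oa : open (bundle_dom a) by exact: open_bundle_dom.
apply: (smooth_fun_eq oa _
  (smooth_funM oa (smooth_fun_cst _ c) (section_smooth X a i))).
by move=> x _; rewrite linearZ_LR mxE.
Qed.
Definition sectionZ (c : R) X : sections E :=
  SmoothSection (sectionZ_subproof c X).

Definition sectionN X : sections E := sectionZ (-1) X.

Fact sectionDA : associative sectionD.
Proof. by move=> X Y Z; apply: section_ext => x /=; rewrite addrA. Qed.
Fact sectionDC : commutative sectionD.
Proof. by move=> X Y; apply: section_ext => x /=; rewrite addrC. Qed.
Fact section0D : left_id section0 sectionD.
Proof. by move=> X; apply: section_ext => x /=; rewrite add0r. Qed.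
Fact sectionND : left_inverse section0 sectionN sectionD.
Proof. by move=> X; apply: section_ext => x /=; rewrite scaleN1r addNr. Qed.

HB.instance Definition _ :=
  GRing.isZmodule.Build (sections E) sectionDA sectionDC section0D sectionND.

Fact sectionZA (a b : R) X : sectionZ a (sectionZ b X) = sectionZ (a * b) X.
Proof. by apply: section_ext => x /=; rewrite scalerA. Qed.
Fact section1Z : left_id 1 sectionZ.
Proof. by move=> X; apply: section_ext => x /=; rewrite scale1r. Qed.
Fact sectionZDr : right_distributive sectionZ +%R.
Proof. by move=> a X Y; apply: section_ext => x /=; rewrite scalerDr. Qed.
Fact sectionZDl X : {morph sectionZ^~ X : a b / a + b}.
Proof. by move=> a b; apply: section_ext => x /=; rewrite scalerDl. Qed.

HB.instance Definition _ := GRing.Zmodule_isLmodule.Build R (sections E)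
  sectionZA section1Z sectionZDr sectionZDl.

Lemma sectionDE X Y x : (X + Y) x = X x + Y x. Proof. by []. Qed.
Lemma sectionZE (c : R) X x : (c *: X) x = c *: X x. Proof. by []. Qed.
Lemma sectionNE X x : (- X) x = - X x.
Proof. by rewrite -scaleN1r. Qed.

End SectionsTheory.

Record morphism (R : realType) (M : manifold R) (E F : bundle M) := Morphism {
  morphism_fun :> forall x, E x -> F x;
  morphism_linear : forall x, linear (@morphism_fun x);
  morphism_smooth : forall a b v,
    smooth_row_on (bundle_dom a `&` bundle_dom b)
      (fun x => bundle_coord b x (@morphism_fun x (bundle_frame a x v))) }.

HB.instance Definition _ (R : realType) (M : manifold R) (E F : bundle M)
    (f : morphism E F) (x : M) :=
  GRing.isLinear.Build R (E x) (F x) _ (f x) (@morphism_linear R M E F f x).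

Arguments morphism_smooth {R M E F}.

Section MorphismTheory.
Context (R : realType) (M : manifold R).
Implicit Types (E F G : bundle M).

Lemma morphism_ext E F (f g : morphism E F) :
  (forall x u, f x u = g x u) -> f = g.
Proof.
case: f g => [f lf sf] [g lg sg] /= fg.
have {}fg : f = g.
  by apply/functional_extensionality_dep => x; apply/funext; exact: fg.
by subst g; congr Morphism; exact: Prop_irrelevance.
Qed.

Lemma smooth_row_morphism E F (f : morphism E F) (U : set M)
    (X : forall x, E x) b : open U ->
  (forall a, smooth_row_on (U `&` bundle_dom a)
     (fun x => bundle_coord a x (X x))) ->
  smooth_row_on (U `&` bundle_dom b) (fun x => bundle_coord b x (f x (X x))).
Proof.
move=> oU sX i; apply: smooth_fun_local => x0 [Ux0 bx0].
have [a ax0] := bundle_cover E x0; exists (bundle_dom a) => //.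
pose W := bundle_dom a `&` (U `&` bundle_dom b).
have oW : open W.
  by apply: openI; [|apply: openI => //]; exact: open_bundle_dom.
have sW : smooth_fun_on W (fun x => \sum_(j < rank a)
    bundle_coord a x (X x) 0 j *
    bundle_coord b x (f x (bundle_frame a x (delta_mx 0 j))) 0 i).
  apply: smooth_fun_sum => // j; apply: smooth_funM => //.
    by apply: smooth_fun_sub (sX a j) => x [ax [Ux bx]].
  by apply: smooth_fun_sub (morphism_smooth f a b (delta_mx 0 j) i) => x [ax []].
apply: smooth_fun_eq sW => // x [ax _] /=.
rewrite -[in RHS](bundle_coordK ax (X x)).
rewrite [in RHS](row_sum_delta (bundle_coord a x (X x))).
rewrite !raddf_sum summxE; apply: eq_bigr => j _.
apply: esym; apply: etrans (congr1 (fun w => bundle_coord b x (f x w) 0 i)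
  (linearZ_LR (bundle_frame a x) _ _)) _.
by rewrite (linearZ_LR (f x)) (linearZ_LR (bundle_coord b x)) mxE.
Qed.

Fact morphism_section_subproof E F (f : morphism E F) (X : sections E) b :
  smooth_row_on (bundle_dom b) (fun x => bundle_coord b x (f x (X x))).
Proof.
have := @smooth_row_morphism E F f setT X b openT; rewrite setTI; apply => a.
by rewrite setTI; exact: section_smooth.
Qed.

Definition morphism_section E F (f : morphism E F) (X : sections E) :
    sections F :=
  SmoothSection (morphism_section_subproof f X).

Fact morphism_comp_linear E F G (g : morphism F G) (f : morphism E F) x :
  linear (fun u => g x (f x u)).
Proof. by move=> c u v; rewrite !linearP. Qed.

Fact morphism_comp_smooth E F G (g : morphism F G) (f : morphism E F) a c v :
  smooth_row_on (bundle_dom a `&` bundle_dom c)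
    (fun x => bundle_coord c x (g x (f x (bundle_frame a x v)))).
Proof.
apply: (@smooth_row_morphism F G g _ (fun x => f x (bundle_frame a x v))).
  exact: open_bundle_dom.
by move=> b; exact: morphism_smooth.
Qed.

Definition morphism_comp E F G (g : morphism F G) (f : morphism E F) :
    morphism E G :=
  Morphism (morphism_comp_linear g f) (morphism_comp_smooth g f).

Fact morphism_scale_linear E F (c : R) (f : morphism E F) x :
  linear (fun u => c *: f x u).
Proof.
by move=> d u v; rewrite linearP scalerDr !scalerA [c * d]mulrC.
Qed.

Fact morphism_scale_smooth E F (c : R) (f : morphism E F) a b v :
  smooth_row_on (bundle_dom a `&` bundle_dom b)
    (fun x => bundle_coord b x (c *: f x (bundle_frame a x v))).
Proof.
move=> i; have oab : open (bundle_dom a `&` bundle_dom b).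
  by apply: openI; exact: open_bundle_dom.
apply: (smooth_fun_eq oab _
  (smooth_funM oab (smooth_fun_cst _ c) (morphism_smooth f a b v i))).
by move=> x _; rewrite linearZ_LR mxE.
Qed.

Definition morphism_scale E F (c : R) (f : morphism E F) : morphism E F :=
  Morphism (morphism_scale_linear c f) (morphism_scale_smooth c f).

Fact morphism_id_linear E x : linear (fun u : E x => u).
Proof. by []. Qed.

Definition morphism_id E : morphism E E :=
  Morphism (@morphism_id_linear E) (@bundle_transition_smooth R M E).

End MorphismTheory.

Definition endomorphism (R : realType) (M : manifold R) (E : bundle M) :=
  morphism E E.

Record metric (R : realType) (M : manifold R) (E : bundle M) := Metric {
  metric_fun :> forall x, E x -> E x -> R;
  metric_linear : forall x u, scalar (@metric_fun x u);
  metric_sym : forall x u v, @metric_fun x u v = @metric_fun x v u;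
  metric_nondegenerate :
    forall x u, (forall v, @metric_fun x u v = 0) -> u = 0;
  metric_smooth : forall a u v, smooth_fun_on (bundle_dom a)
    (fun x => @metric_fun x (bundle_frame a x u) (bundle_frame a x v)) }.

(* [X x] consists of the components of a tangent vector in the chart
   [chart_at x], hence the derivative is taken in that chart. *)
Definition vector_field_action (R : realType) (M : manifold R)
    (X : sections (tangent_bundle M)) (f : M -> R) : M -> R :=
  fun x => 'd (f \o chart_inv (chart_at x)) (chart_fun (chart_at x) x) (X x).

Record anchored_bracket (R : realType) (M : manifold R) (E : bundle M) :=
  AnchoredBracket {
    anchor : morphism E (tangent_bundle M);
    bracket : sections E -> sections E -> sections E }.

Record pre_courant (R : realType) (M : manifold R) (E : bundle M)
    (g : metric E) (Theta : anchored_bracket E) : Prop := PreCourant {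
  bracket_linearl : forall Y, linear (fun X => bracket Theta X Y);
  bracket_linearr : forall X, linear (bracket Theta X);
  bracket_metric : forall (X Y Z : sections E) x,
    vector_field_action (morphism_section (anchor Theta) X)
      (fun y => g y (Y y) (Z y)) x =
    g x (bracket Theta X Y x) (Z x) + g x (Y x) (bracket Theta X Z x);
  bracket_symmetric_part : forall (X Y Z : sections E) x,
    vector_field_action (morphism_section (anchor Theta) X)
      (fun y => g y (Y y) (Z y)) x =
    g x (X x) ((bracket Theta Y Z + bracket Theta Z Y) x) }.

Section Structures.
Context (R : realType) (M : manifold R) (E : bundle M).
Implicit Types (Theta : anchored_bracket E) (I J : endomorphism E).

Definition skew_symmetric (g : metric E) I : Prop :=
  forall x u v, g x (I x u) v = - g x u (I x v).

Definition deform Theta I : anchored_bracket E :=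
  AnchoredBracket (morphism_comp (anchor Theta) I)
    (fun X Y => bracket Theta (morphism_section I X) Y
              + bracket Theta X (morphism_section I Y)
              - morphism_section I (bracket Theta X Y)).

Definition scale_structure (c : R) Theta : anchored_bracket E :=
  AnchoredBracket (morphism_scale c (anchor Theta))
    (fun X Y => c *: bracket Theta X Y).

(* The indices 1, 2, 3 are elements of ['Z_3], where 3 = 0. *)
Record eps_hypersymplectic (eps : 'Z_3 -> R) (g : metric E) Theta
    (S : 'Z_3 -> endomorphism E) : Prop := EpsHypersymplectic {
  eps_sign : forall i, eps i = 1 \/ eps i = -1;
  hs_pre_courant : pre_courant g Theta;
  hs_skew : forall i, skew_symmetric g (S i);
  hs_square : forall i,
    morphism_comp (S i) (S i) = morphism_scale (eps i) (morphism_id E);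
  hs_commutation : forall i j, i != j ->
    morphism_comp (S i) (S j) =
    morphism_scale (eps 1 * eps 2 * eps 3) (morphism_comp (S j) (S i));
  hs_deform : forall i,
    deform (deform Theta (S i)) (S i) = scale_structure (eps i) Theta }.

Definition hypersymplectic (eps : 'Z_3 -> R) (g : metric E) Theta
    (S : 'Z_3 -> endomorphism E) : Prop :=
  eps_hypersymplectic eps g Theta S /\ (forall i, eps i = -1).

(* All three positions of the sign -1 are allowed; the usual normalisation
   [eps 1 = eps 2 = 1] and [eps 3 = -1] is one of them. *)
Definition para_hypersymplectic (eps : 'Z_3 -> R) (g : metric E) Theta
    (S : 'Z_3 -> endomorphism E) : Prop :=
  [/\ eps_hypersymplectic eps g Theta S,
      eps 1 * eps 2 * eps 3 = -1 & ~ (forall i, eps i = -1)].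

Definition transition_morphism (eps : 'Z_3 -> R)
    (S : 'Z_3 -> endomorphism E) (j : 'Z_3) : endomorphism E :=
  morphism_scale (eps (j - 1)) (morphism_comp (S (j - 1)) (S (j + 1))).

End Structures.

(* Main.v *)
(* For skew-symmetric [I], deforming the bracket amounts to letting [I] act as
   a derivation [D_I] on the form [<[X, Y], w>], while the anchor conditions
   are purely algebraic.  If [S_i^2 = e_i], the slotwise actions square to [e_i]
   and commute, so (D_i^2 - e_i)(D_i^2 - 9 e_i) = 0 and [D_i] is invertible.
   If [I] and [J] anticommute with squares [e] and [f], then
   [D_I, D_J] = -2 D_IJ and [[D_I, D_J], D_J] = 4 f D_I.  On a structure fixed up
   to the signs [e], [f] by [D_I^2], [D_J^2], this gives
   D_IJ (D_I D_J + D_J D_I) = 0, hence D_I D_J = - D_J D_I as [D_IJ] is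
   invertible, and then D_J^2 D_I = f D_I: the deformed structure satisfies the
   same equations.  Moreover D_IJ = D_J D_I there, so the case of [T_j] is two
   successive deformations.  The converse directions follow by deforming once
   more: [D_T^3 = d D_T] on the structure forces [D_T^2 = d]. *)

From HB Require Import structures.
Require Import Defs.
From mathcomp Require Import all_boot all_order all_algebra.
From mathcomp Require Import all_classical all_reals all_analysis.
From mathcomp Require Import ring lra.

Set Implicit Arguments.
Unset Strict Implicit.
Unset Printing Implicit Defensive.
Import Order.TTheory GRing.Theory Num.Theory.

Local Open Scope ring_scope.

(** * Slotwise derivations acting on functions of three vectors *)

Section Derivation.
Context (R : realFieldType) (V W : lmodType R).
Implicit Types (T U : V -> V -> W -> R).

(** Iterating [derivation3] only ever puts composites of the operators into a slot; their squares
    and sign changes contribute scalars, which homogeneity pulls out. *)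
Definition homogeneous3 T : Prop :=
  [/\ forall c X Y w, T (c *: X) Y w = c * T X Y w,
      forall c X Y w, T X (c *: Y) w = c * T X Y w
    & forall c X Y w, T X Y (c *: w) = c * T X Y w].

(** Two operators occur because the first two slots will hold sections and the third a vector of a
    single fibre. *)
Definition derivation3 (I : V -> V) (I' : W -> W) T : V -> V -> W -> R :=
  fun X Y w => T (I X) Y w + T X (I Y) w + T X Y (I' w).

Lemma homogeneous3_derivation I I' T : scalable I -> scalable I' ->
  homogeneous3 T -> homogeneous3 (derivation3 I I' T).
Proof.
by move=> sI sI' [h1 h2 h3]; split=> c X Y w; rewrite /derivation3 ?sI ?sI'
  ?(h1, h2, h3) !mulrDr.
Qed.

Lemma derivation3_scale I I' T U c :
  (forall X Y w, T X Y w = c * U X Y w) ->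
  forall X Y w, derivation3 I I' T X Y w = c * derivation3 I I' U X Y w.
Proof. by move=> TU X Y w; rewrite /derivation3 !TU -!mulrDr. Qed.

Section OneOperator.
Variables (I : V -> V) (I' : W -> W) (e : R).
Hypotheses (sI : scalable I) (sI' : scalable I').
Hypotheses (II : forall v, I (I v) = e *: v) (II' : forall w, I' (I' w) = e *: w).
Let D := derivation3 I I'.

(* The three summands of [D] commute and square to [e], so over an algebraic
   closure [D / sqrt e] has eigenvalues among 1, -1, 3, -3. *)
Lemma derivation3_quartic T X Y w : homogeneous3 T ->
  D (D (D (D T))) X Y w = 10 * e * D (D T) X Y w - 9 * e ^+ 2 * T X Y w.
Proof.
move=> [h1 h2 h3]; rewrite /D /derivation3.
rewrite !(II, II', sI, sI', h1, h2, h3); ring.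
Qed.

(** When [D T] vanishes, the quartic relation reduces to 9 e^2 T = 0. *)
Lemma derivation3_inj T : e != 0 -> homogeneous3 T ->
  (forall X Y w, D T X Y w = 0) -> forall X Y w, T X Y w = 0.
Proof.
move=> e0 hT DT X Y w.
have D0 U : (forall X Y w, U X Y w = 0) -> forall X Y w, D U X Y w = 0.
  by move=> U0 X' Y' w'; rewrite /D /derivation3 !U0 !addr0.
have := derivation3_quartic X Y w hT.
have D2 := D0 _ DT; have D4 := D0 _ (D0 _ D2).
rewrite D2 D4 mulr0 sub0r => /eqP; rewrite eq_sym oppr_eq0 mulf_eq0.
by rewrite mulf_eq0 pnatr_eq0 expf_eq0 (negbTE e0) => /eqP.
Qed.

(** Applying [D] to the cubic relation gives D^4 T = e D^2 T, and the quartic relation then becomes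
    9 e D^2 T = 9 T. *)
Lemma derivation3_inv T : e ^+ 2 = 1 -> homogeneous3 T ->
  (forall X Y w, D (D (D T)) X Y w = e * D T X Y w) ->
  forall X Y w, D (D T) X Y w = e * T X Y w.
Proof.
move=> ee hT DT X Y w.
have := derivation3_quartic X Y w hT.
have -> : D (D (D (D T))) X Y w = e * D (D T) X Y w by exact: derivation3_scale.
rewrite ee => DD.
suff -> : T X Y w = e * D (D T) X Y w by rewrite mulrA -expr2 ee mul1r.
lra.
Qed.

End OneOperator.

(** * Derivations of two anticommuting operators *)

Section TwoOperators.
Variables (I J : V -> V) (I' J' : W -> W) (e f : R).
Hypotheses (sI : scalable I) (sI' : scalable I').
Hypotheses (sJ : scalable J) (sJ' : scalable J').
Hypotheses (II : forall v, I (I v) = e *: v) (II' : forall w, I' (I' w) = e *: w).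
Hypotheses (JJ : forall v, J (J v) = f *: v) (JJ' : forall w, J' (J' w) = f *: w).
Hypotheses (JI : forall v, J (I v) = (-1) *: I (J v)).
Hypotheses (JI' : forall w, J' (I' w) = (-1) *: I' (J' w)).
Let D := derivation3 I I'.
Let F := derivation3 J J'.
Let C := derivation3 (I \o J) (I' \o J').

(** Terms with [I] and [J] in different slots cancel. Within a slot [D (F T)] evaluates [T] at J I
    and [F (D T)] at I J, and J I - I J = -2 I J. *)
Lemma derivation3_commutator T X Y w : homogeneous3 T ->
  D (F T) X Y w - F (D T) X Y w = - 2 * C T X Y w.
Proof.
move=> [h1 h2 h3]; rewrite /C /D /F /derivation3 /=.
rewrite !(II, II', JJ, JJ', JI, JI', sI, sI', sJ, sJ', h1, h2, h3); ring.
Qed.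

Lemma derivation3_double_commutator T X Y w : homogeneous3 T ->
  D (F (F T)) X Y w - 2 * F (D (F T)) X Y w + F (F (D T)) X Y w =
  4 * f * D T X Y w.
Proof.
move=> [h1 h2 h3]; rewrite /D /F /derivation3.
rewrite !(II, II', JJ, JJ', JI, JI', sI, sI', sJ, sJ', h1, h2, h3); ring.
Qed.

Let A T X Y w := D (F T) X Y w + F (D T) X Y w.

(** This is the expansion of [D^2, F^2] by [D, F] = -2 C, [C, F] = -2 f D and [D, C] = -2 e F. The
    right-hand side vanishes on a common eigenvector of D^2 and F^2 with eigenvalues e and f. *)
Lemma derivation3_commutator_anticommutator T X Y w : homogeneous3 T ->
  - 4 * C (A T) X Y w = D (D (F (F T))) X Y w - F (F (D (D T))) X Y w +
    8 * (f * D (D T) X Y w - e * F (F T) X Y w).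
Proof.
move=> [h1 h2 h3]; rewrite /A /C /D /F /derivation3 /=.
rewrite !(II, II', JJ, JJ', JI, JI', sI, sI', sJ, sJ', h1, h2, h3).
ring.
Qed.

Section Eigenvector.
Variable T : V -> V -> W -> R.
Hypotheses (hT : homogeneous3 T).
Hypotheses (e1 : e ^+ 2 = 1) (f1 : f ^+ 2 = 1).
Hypothesis DDT : forall X Y w, D (D T) X Y w = e * T X Y w.
Hypothesis FFT : forall X Y w, F (F T) X Y w = f * T X Y w.

Let ef_neq0 : - (e * f) != 0.
Proof.
apply/negP => /eqP z.
have : (- (e * f)) ^+ 2 = 1 by rewrite sqrrN exprMn e1 f1 mulr1.
by rewrite z expr0n /= => /eqP; rewrite eq_sym oner_eq0.
Qed.

Lemma derivation3_anticommute X Y w : D (F T) X Y w = - F (D T) X Y w.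
Proof.
suff : A T X Y w = 0 by rewrite /A => /eqP; rewrite addr_eq0 => /eqP.
have hD U : homogeneous3 U -> homogeneous3 (D U).
  exact: homogeneous3_derivation.
have hF U : homogeneous3 U -> homogeneous3 (F U).
  exact: homogeneous3_derivation.
(* The constant is the square of I J: I J I J = - I^2 J^2. *)
apply: (@derivation3_inj (I \o J) (I' \o J') (- (e * f))) => //=.
- by move=> c v; rewrite /= sJ sI.
- by move=> c v; rewrite /= sJ' sI'.
- by move=> v; rewrite JI sI II JJ !scalerA; congr (_ *: _); ring.
- by move=> v; rewrite JI' sI' II' JJ' !scalerA; congr (_ *: _); ring.
- have [a1 a2 a3] := hD _ (hF _ hT); have [b1 b2 b3] := hF _ (hD _ hT).
  by split=> c ? ? ?; rewrite /A [RHS]mulrDr ?(a1, a2, a3) ?(b1, b2, b3).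
move=> {}X {}Y {}w; have := derivation3_commutator_anticommutator X Y w hT.
have -> : D (D (F (F T))) X Y w = f * D (D T) X Y w.
  by do 2 apply: derivation3_scale.
have -> : F (F (D (D T))) X Y w = e * F (F T) X Y w.
  by do 2 apply: derivation3_scale.
rewrite -/C DDT FFT; lra.
Qed.

(** Substituting F D F T = - F^2 D T and D F^2 T = f D T into the double commutator leaves 3 F^2 D T
    = 3 f D T. *)
Lemma derivation3_square_stable X Y w : F (F (D T)) X Y w = f * D T X Y w.
Proof.
have := derivation3_double_commutator X Y w hT.
have FDF : F (D (F T)) X Y w = -1 * F (F (D T)) X Y w.
  apply: derivation3_scale => X' Y' w'.
  by rewrite derivation3_anticommute mulN1r.
have DFF : D (F (F T)) X Y w = f * D T X Y w by exact: derivation3_scale.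
rewrite FDF DFF; lra.
Qed.

Lemma derivation3_comp X Y w : C T X Y w = F (D T) X Y w.
Proof.
have := derivation3_commutator X Y w hT.
rewrite derivation3_anticommute; lra.
Qed.

End Eigenvector.
End TwoOperators.
End Derivation.

(** * Deformation of pre-Courant structures by skew-symmetric endomorphisms *)

HB.instance Definition _ (R : realType) (M : manifold R) (E : bundle M)
    (g : metric E) (x : M) (u : E x) :=
  GRing.isLinear.Build R (E x) R _ (g x u) (@metric_linear R M E g x u).

Fact morphism_section_linear (R : realType) (M : manifold R) (E F : bundle M)
  (f : morphism E F) : linear (morphism_section f).
Proof. by move=> c X Y; apply: section_ext => x /=; rewrite linearP. Qed.

HB.instance Definition _ (R : realType) (M : manifold R) (E F : bundle M)
    (f : morphism E F) :=
  GRing.isLinear.Build R (sections E) (sections F) _ (morphism_section f)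
    (morphism_section_linear f).

Section Deformation.
Context (R : realType) (M : manifold R) (E : bundle M) (g : metric E).
Implicit Types (Theta : anchored_bracket E) (I J : endomorphism E).

Lemma metricDl x u u' v : g x (u + u') v = g x u v + g x u' v.
Proof. by rewrite Defs.metric_sym linearD /= !(Defs.metric_sym _ v). Qed.

Lemma metricNl x u v : g x (- u) v = - g x u v.
Proof. by rewrite Defs.metric_sym linearN /= (Defs.metric_sym _ v). Qed.

Lemma metricZl x c u v : g x (c *: u) v = c * g x u v.
Proof. by rewrite Defs.metric_sym linearZ /= (Defs.metric_sym _ v). Qed.

Lemma metric_inj x u u' : (forall v, g x u v = g x u' v) -> u = u'.
Proof.
move=> uu'; apply/eqP; rewrite -subr_eq0; apply/eqP.
by apply: (metric_nondegenerate (m := g)) => v; rewrite metricDl metricNl uu' subrr.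
Qed.

Lemma anchored_bracket_ext Theta Theta' :
  (forall x u, anchor Theta x u = anchor Theta' x u) ->
  (forall X Y, bracket Theta X Y = bracket Theta' X Y) -> Theta = Theta'.
Proof.
case: Theta Theta' => [a b] [a' b'] /= aa' bb'.
by rewrite (@morphism_ext _ _ _ (tangent_bundle M) _ _ aa'); congr AnchoredBracket; apply/funext => X;
  apply/funext => Y.
Qed.

(** The axioms at I X account for the terms containing I X. The remaining terms cancel by [skew],
    the derivative along X of <I Y, Z> + <Y, I Z> = 0, expanded by the axiom at hand. *)
Lemma pre_courant_deform Theta I :
  pre_courant g Theta -> skew_symmetric g I -> pre_courant g (deform Theta I).
Proof.
move=> cT sI; case: (cT) => linl linr inv sym.
have anchorE X : morphism_section (anchor (deform Theta I)) X =
    morphism_section (anchor Theta) (morphism_section I X).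
  by apply: section_ext.
have brN X Y : bracket Theta X (- Y) = - bracket Theta X Y.
  by rewrite -[- Y]scaleN1r (scalable_linear (linr X)) -[RHS]scaleN1r.
have skew (X Y Z : sections E) x : vector_field_action (morphism_section (anchor Theta) X)
      (fun y => g y (morphism_section I Y y) (Z y)) x +
    vector_field_action (morphism_section (anchor Theta) X)
      (fun y => g y (Y y) (morphism_section I Z y)) x = 0.
  (* The sign is put on the section [Y], so that it passes through the bracket instead of the
     derivative. *)
  have -> : (fun y => g y (morphism_section I Y y) (Z y)) =
      (fun y => g y ((- Y) y) (morphism_section I Z y)).
    by apply/funext => y; rewrite sectionNE metricNl /= sI.
  by rewrite !inv brN !sectionNE !metricNl -opprD addNr.
split.
- move=> Y c X X'; rewrite [LHS]/= linearP !linl linearP scalerBr scalerDr opprD.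
  by rewrite (addrACA (c *: _) _ (c *: _)) [LHS]addrACA.
- move=> X c Y Y'; rewrite [LHS]/= linearP !linr linearP scalerBr scalerDr opprD.
  by rewrite (addrACA (c *: _) _ (c *: _)) [LHS]addrACA.
- move=> X Y Z x; rewrite anchorE inv; have := skew X Y Z x; rewrite !inv.
  rewrite ![bracket (deform _ _) _ _]/= !sectionDE !sectionNE !metricDl metricNl.
  rewrite !linearD linearN /= !sI; lra.
- move=> X Y Z x; rewrite anchorE sym; have := skew X Y Z x; rewrite !sym.
  rewrite ![bracket (deform _ _) _ _]/= !sectionDE !sectionNE !linearD !linearN.
  rewrite /= !sI; lra.
Qed.

(* [w] is a fibre vector, not a section: this avoids having to extend vectors to
   global sections when using nondegeneracy. *)
Definition bracket_form Theta (x : M) (X Y : sections E) (w : E x) : R :=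
  g x (bracket Theta X Y x) w.
Arguments bracket_form : clear implicits.

Lemma bracket_form_homogeneous Theta x : pre_courant g Theta ->
  homogeneous3 (bracket_form Theta x).
Proof.
case=> linl linr _ _; split=> c X Y w; rewrite /bracket_form.
- by rewrite (scalable_linear (linl Y)) metricZl.
- by rewrite (scalable_linear (linr X)) metricZl.
- by rewrite linearZ.
Qed.

(** Skew-symmetry turns -<I [X, Y], w> into +<[X, Y], I w>, the third summand of the derivation. *)
Lemma bracket_form_deform Theta I x : skew_symmetric g I ->
  bracket_form (deform Theta I) x =
  derivation3 (morphism_section I) (I x) (bracket_form Theta x).
Proof.
move=> sI; apply/funext => X; apply/funext => Y; apply/funext => w.
rewrite /bracket_form /derivation3 [bracket (deform _ _) _ _]/=.
rewrite !sectionDE sectionNE !metricDl metricNl.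
by rewrite /= sI opprK.
Qed.

Lemma bracket_form_scale Theta c x X Y w :
  bracket_form (scale_structure c Theta) x X Y w = c * bracket_form Theta x X Y w.
Proof. by rewrite /bracket_form metricZl. Qed.

Lemma bracket_form_inj Theta Theta' :
  (forall x u, anchor Theta x u = anchor Theta' x u) ->
  (forall x X Y w, bracket_form Theta x X Y w = bracket_form Theta' x X Y w) ->
  Theta = Theta'.
Proof.
move=> aa' bb'; apply: anchored_bracket_ext => // X Y.
by apply: section_ext => x; apply: metric_inj => w; exact: bb'.
Qed.

Lemma deform_scale Theta I c :
  deform (scale_structure c Theta) I = scale_structure c (deform Theta I).
Proof.
apply: anchored_bracket_ext => //= X Y.
by rewrite linearZ scalerBr scalerDr.
Qed.

Lemma scale_structureA Theta c d :
  scale_structure c (scale_structure d Theta) = scale_structure (c * d) Theta.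
Proof. by apply: anchored_bracket_ext => * /=; rewrite scalerA. Qed.

Lemma scale_structure1 Theta : scale_structure 1 Theta = Theta.
Proof. by apply: anchored_bracket_ext => * /=; rewrite scale1r. Qed.

Lemma skew_symmetric_scale I c :
  skew_symmetric g I -> skew_symmetric g (morphism_scale c I).
Proof. by move=> sI x u v /=; rewrite metricZl linearZ /= sI mulrN. Qed.

Section OneEndomorphism.
Variables (I : endomorphism E) (e : R).
Hypothesis II : morphism_comp I I = morphism_scale e (morphism_id E).

Lemma morphism_square x u : I x (I x u) = e *: u.
Proof. by have := congr1 (fun f : morphism E E => f x u) II. Qed.

Lemma section_square X : morphism_section I (morphism_section I X) = e *: X.
Proof. by apply: section_ext => x; exact: morphism_square. Qed.

(** Cancels one deformation, which is how equations descend from [deform Theta I] to [Theta]. On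
    anchors the conclusion is I^2 = e; on bracket forms it is [derivation3_inv]. *)
Lemma deform_inv Theta : skew_symmetric g I -> e ^+ 2 = 1 ->
  pre_courant g Theta ->
  deform (deform (deform Theta I) I) I = scale_structure e (deform Theta I) ->
  deform (deform Theta I) I = scale_structure e Theta.
Proof.
move=> sI e1 cT DDD; apply: bracket_form_inj => [x u|x X Y w].
  by rewrite /= morphism_square linearZ.
rewrite bracket_form_scale !bracket_form_deform //.
apply: derivation3_inv => //.
- by move=> c v; rewrite linearZ.
- by move=> c v; rewrite linearZ.
- exact: section_square.
- exact: morphism_square.
- exact: bracket_form_homogeneous.
move=> {}X {}Y {}w; rewrite -!bracket_form_deform // DDD.
exact: bracket_form_scale.
Qed.

End OneEndomorphism.

(** * Successive deformations by two anticommuting endomorphisms *)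

Section TwoEndomorphisms.
Variables (I J : endomorphism E) (e f : R) (Theta : anchored_bracket E).
Hypotheses (sI : skew_symmetric g I) (sJ : skew_symmetric g J).
Hypothesis II : morphism_comp I I = morphism_scale e (morphism_id E).
Hypothesis JJ : morphism_comp J J = morphism_scale f (morphism_id E).
Hypothesis JI : morphism_comp J I = morphism_scale (-1) (morphism_comp I J).
Hypotheses (e1 : e ^+ 2 = 1) (f1 : f ^+ 2 = 1).

Lemma morphism_anticommute x u : J x (I x u) = (-1) *: I x (J x u).
Proof. by have := congr1 (fun f : morphism E E => f x u) JI. Qed.

Lemma section_anticommute X : morphism_section J (morphism_section I X) =
  (-1) *: morphism_section I (morphism_section J X).
Proof. by apply: section_ext => x; exact: morphism_anticommute. Qed.

(** The adjoint of I J is J I, which equals - I J. *)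
Lemma skew_symmetric_comp : skew_symmetric g (morphism_comp I J).
Proof.
by move=> x u v /=; rewrite sI sJ opprK morphism_anticommute linearZ /= mulN1r.
Qed.

Lemma comp_square : morphism_comp (morphism_comp I J) (morphism_comp I J) =
  morphism_scale (- (e * f)) (morphism_id E).
Proof.
apply: morphism_ext => x u /=; rewrite morphism_anticommute linearZ /=.
by rewrite (morphism_square II) (morphism_square JJ) !scalerA;
  congr (_ *: _); ring.
Qed.

Hypothesis cT : pre_courant g Theta.
Hypothesis TII : deform (deform Theta I) I = scale_structure e Theta.
Hypothesis TJJ : deform (deform Theta J) J = scale_structure f Theta.

Lemma form_II x X Y w : derivation3 (morphism_section I) (I x)
    (derivation3 (morphism_section I) (I x) (bracket_form Theta x)) X Y w =
  e * bracket_form Theta x X Y w.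
Proof. by rewrite -!bracket_form_deform // TII bracket_form_scale. Qed.

Lemma form_JJ x X Y w : derivation3 (morphism_section J) (J x)
    (derivation3 (morphism_section J) (J x) (bracket_form Theta x)) X Y w =
  f * bracket_form Theta x X Y w.
Proof. by rewrite -!bracket_form_deform // TJJ bracket_form_scale. Qed.

Let hom x := bracket_form_homogeneous x cT.

Let scalable_section (K : endomorphism E) : scalable (morphism_section K).
Proof. by move=> c X; rewrite linearZ. Qed.

Let scalable_fibre (K : endomorphism E) x : scalable (K x).
Proof. by move=> c X; rewrite linearZ. Qed.

Lemma deform_anticommute :
  deform (deform Theta J) I = scale_structure (-1) (deform (deform Theta I) J).
Proof.
apply: bracket_form_inj => [x u|x X Y w].
  by rewrite /= morphism_anticommute linearZ.
rewrite bracket_form_scale !bracket_form_deform // mulN1r.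
apply: (@derivation3_anticommute _ _ _ _ _ _ _ e f) => //.
- exact: section_square.
- exact: morphism_square.
- exact: section_square.
- exact: morphism_square.
- exact: section_anticommute.
- exact: morphism_anticommute.
- exact: form_II.
- exact: form_JJ.
Qed.

Lemma deform_square_stable :
  deform (deform (deform Theta I) J) J = scale_structure f (deform Theta I).
Proof.
apply: bracket_form_inj => [x u|x X Y w].
  by rewrite /= (morphism_square JJ) !linearZ.
rewrite bracket_form_scale !bracket_form_deform //.
apply: (@derivation3_square_stable _ _ _ _ _ _ _ e f) => //.
- exact: section_square.
- exact: morphism_square.
- exact: section_square.
- exact: morphism_square.
- exact: section_anticommute.
- exact: morphism_anticommute.
- exact: form_II.
- exact: form_JJ.
Qed.

Lemma deform_comp : deform Theta (morphism_comp I J) = deform (deform Theta I) J.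
Proof.
apply: bracket_form_inj => [x u|x X Y w] //.
rewrite bracket_form_deform; last exact: skew_symmetric_comp.
rewrite !bracket_form_deform //.
have -> : morphism_section (morphism_comp I J) =
    morphism_section I \o morphism_section J.
  by apply/funext => Z; apply: section_ext.
apply: (@derivation3_comp _ _ _ _ _ _ _ e f) => //.
- exact: section_square.
- exact: morphism_square.
- exact: section_square.
- exact: morphism_square.
- exact: section_anticommute.
- exact: morphism_anticommute.
- exact: form_II.
- exact: form_JJ.
Qed.

End TwoEndomorphisms.
End Deformation.

(** * Triples of pairwise anticommuting endomorphisms and their transition morphisms *)

Section Triples.
Context (R : realType) (M : manifold R) (E : bundle M) (g : metric E).
Variables (S : 'Z_3 -> endomorphism E) (eps : 'Z_3 -> R).
Implicit Types Theta : anchored_bracket E.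

(** Apart from the pre-Courant axioms, this is the clause of an eps-hypersymplectic structure that
    involves [Theta]; the others concern only the triple, the metric and the signs. *)
Definition deformation_eigen Theta : Prop :=
  forall k, deform (deform Theta (S k)) (S k) = scale_structure (eps k) Theta.

Lemma deformation_eigen_scale Theta c :
  deformation_eigen Theta -> deformation_eigen (scale_structure c Theta).
Proof. by move=> eT k; rewrite !deform_scale eT !scale_structureA mulrC. Qed.

Hypothesis eps1 : forall k, eps k ^+ 2 = 1.
Hypothesis skewS : forall k, skew_symmetric g (S k).
Hypothesis SS : forall k,
  morphism_comp (S k) (S k) = morphism_scale (eps k) (morphism_id E).
Hypothesis SC : forall k l, k != l ->
  morphism_comp (S k) (S l) = morphism_scale (-1) (morphism_comp (S l) (S k)).

Lemma deformation_eigen_deform Theta i : pre_courant g Theta ->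
  deformation_eigen Theta -> deformation_eigen (deform Theta (S i)).
Proof.
move=> cT eT k; have [->|ki] := eqVneq k i; first by rewrite eT deform_scale.
by apply: (@deform_square_stable _ _ _ g (S i) (S k) (eps i)); auto.
Qed.

Lemma deformation_eigen_deformP Theta i : pre_courant g Theta ->
  deformation_eigen Theta <-> deformation_eigen (deform Theta (S i)).
Proof.
move=> cT; split=> [|eTi]; first exact: deformation_eigen_deform.
(* The hypothesis at the index [i] is the cubic relation that [deform_inv] reduces. *)
have eTii : deform (deform Theta (S i)) (S i) = scale_structure (eps i) Theta.
  by apply: deform_inv; eauto.
have cTi : pre_courant g (deform Theta (S i)) by exact: pre_courant_deform.
(* As [eps i] squares to 1, [Theta] is [eps i] times its second deformation, which inherits the
   property from the first. *)
have := deformation_eigen_scale (eps i) (deformation_eigen_deform i cTi eTi).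
by rewrite eTii scale_structureA -expr2 eps1 scale_structure1.
Qed.

Variable j : 'Z_3.

Let I := S (j - 1).
Let J := S (j + 1).
Let T := transition_morphism eps S j.

Let j_neq : j + 1 != j - 1.
Proof. by case: j => [[|[|[|?]]]]. Qed.

Lemma skew_symmetric_transition : skew_symmetric g T.
Proof. by apply/skew_symmetric_scale/skew_symmetric_comp; auto. Qed.

(** The factor [eps (j - 1)] squares to 1, which leaves the square of the composite. If the product
    of the three signs is -1, the resulting scalar is [eps j]. *)
Lemma transition_square : morphism_comp T T =
  morphism_scale (- (eps (j - 1) * eps (j + 1))) (morphism_id E).
Proof.
rewrite -(comp_square (SS (j - 1)) (SS (j + 1)) (SC j_neq)).
by apply: morphism_ext => x u /=; rewrite !linearZ /= scalerA -expr2 eps1 scale1r.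
Qed.

Lemma deform_transition Theta : pre_courant g Theta -> deformation_eigen Theta ->
  deform Theta T = scale_structure (eps (j - 1)) (deform (deform Theta I) J).
Proof.
move=> cT eT.
have <- : deform Theta (morphism_comp I J) = deform (deform Theta I) J.
  exact: (deform_comp (skewS _) (skewS _) (SS _) (SS _) (SC j_neq)
    (eps1 _) (eps1 _) cT (eT _) (eT _)).
apply: bracket_form_inj (g) _ _ _ _ => [x u|x X Y w].
  by rewrite /= linearZ.
have sIJ : skew_symmetric g (morphism_comp I J).
  exact: skew_symmetric_comp (skewS _) (skewS _) (SC j_neq).
rewrite bracket_form_scale !bracket_form_deform //.
  have [h1 h2 h3] := bracket_form_homogeneous x cT.
  rewrite /derivation3 /= h3.
  have TE Z : morphism_section T Z =
    eps (j - 1) *: morphism_section (morphism_comp I J) Z.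
    by apply: section_ext.
  by rewrite !TE h1 h2 !mulrDr.
exact: skew_symmetric_transition.
Qed.

Lemma deformation_eigen_transition Theta : pre_courant g Theta ->
  deformation_eigen Theta -> deformation_eigen (deform Theta T).
Proof.
move=> cT eT; rewrite deform_transition //; apply: deformation_eigen_scale.
apply: deformation_eigen_deform; first exact: pre_courant_deform cT (skewS _).
exact: deformation_eigen_deform.
Qed.

(** Deforming by [T] twice is deforming by I, J, I, J, since the two factors [eps (j - 1)] cancel.
    Exchanging the middle pair costs a sign and leaves the squares of I and J. *)
Lemma deform_transition_square Theta :
  pre_courant g Theta -> deformation_eigen Theta ->
  deform (deform Theta T) T =
  scale_structure (- (eps (j - 1) * eps (j + 1))) Theta.
Proof.
move=> cT eT.
have cTI : pre_courant g (deform Theta I).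
  exact: pre_courant_deform cT (skewS _).
have eTI := deformation_eigen_deform (j - 1) cT eT.
have cTIJ : pre_courant g (deform (deform Theta I) J).
  exact: pre_courant_deform cTI (skewS _).
have eTIJ := deformation_eigen_deform (j + 1) cTI eTI.
rewrite (deform_transition cT eT) deform_scale deform_transition //.
rewrite scale_structureA -expr2 eps1 scale_structure1.
(* The exchange takes place on the structure already deformed by I, which is again an
   eigenvector. *)
rewrite (deform_anticommute (skewS (j - 1)) (skewS (j + 1)) (SS _) (SS _)
  (SC j_neq) _ _ cTI (eTI _) (eTI _)) //.
rewrite deform_scale eT !deform_scale eT !scale_structureA.
by congr scale_structure; rewrite mulN1r mulNr.
Qed.

Lemma deformation_eigen_transitionP Theta : pre_courant g Theta ->
  deformation_eigen Theta <-> deformation_eigen (deform Theta T).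
Proof.
move=> cT; split=> [|eT]; first exact: deformation_eigen_transition.
have cTT : pre_courant g (deform Theta T).
  by apply: pre_courant_deform => //; exact: skew_symmetric_transition.
set d := - (eps (j - 1) * eps (j + 1)).
have d1 : d ^+ 2 = 1 by rewrite sqrrN exprMn !eps1 mulr1.
(* The square formula is known on [deform Theta T], where it is a cubic relation for [Theta];
   [deform_inv] removes one deformation. *)
have TT : deform (deform Theta T) T = scale_structure d Theta.
  exact (deform_inv transition_square skew_symmetric_transition d1 cT
    (deform_transition_square cTT eT)).
have := deformation_eigen_scale d (deformation_eigen_transition cTT eT).
by rewrite TT scale_structureA -expr2 d1 scale_structure1.
Qed.

End Triples.

(** * The equivalences for sign product -1, and the two cases of the theorem *)

Lemma eps_hypersymplectic_deformP (R : realType) (M : manifold R) (E : bundle M)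
    (g : metric E) (Theta : anchored_bracket E) (S : 'Z_3 -> endomorphism E)
    (eps : 'Z_3 -> R) (i j : 'Z_3) :
  pre_courant g Theta -> eps 1 * eps 2 * eps 3 = -1 ->
  (eps_hypersymplectic eps g Theta S <->
     eps_hypersymplectic eps g (deform Theta (S i)) S) /\
  (eps_hypersymplectic eps g Theta S <->
     eps_hypersymplectic eps g (deform Theta (transition_morphism eps S j)) S).
Proof.
move=> cT epsN.
(* The facts about signs and anticommutation are extracted for an arbitrary [Phi], as each
   implication starts from a different structure. *)
have eps1 Phi : eps_hypersymplectic eps g Phi S -> forall k, eps k ^+ 2 = 1.
  by move=> [sgn _ _ _ _ _] k; have [->|->] := sgn k; rewrite ?sqrrN expr1n.
have SC Phi : eps_hypersymplectic eps g Phi S -> forall k l, k != l ->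
    morphism_comp (S k) (S l) = morphism_scale (-1) (morphism_comp (S l) (S k)).
  by move=> [_ _ _ _ + _] k l kl => /(_ k l kl); rewrite epsN.
have hs Phi Psi : pre_courant g Psi ->
    (deformation_eigen S eps Phi -> deformation_eigen S eps Psi) ->
    eps_hypersymplectic eps g Phi S -> eps_hypersymplectic eps g Psi S.
  by move=> cPsi PhiPsi [sgn _ skewS SS SC' eP]; split=> //; exact: PhiPsi.
split; split=> h; have e1 := eps1 _ h; have sc := SC _ h;
  case: (h) => _ _ skewS SS _ _; apply: hs h => //.
- exact: pre_courant_deform.
- by have [] := deformation_eigen_deformP e1 skewS SS sc i cT.
- by have [] := deformation_eigen_deformP e1 skewS SS sc i cT.
- by apply: pre_courant_deform => //; exact: skew_symmetric_transition.
- by have [] := deformation_eigen_transitionP e1 skewS SS sc j cT.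
- by have [] := deformation_eigen_transitionP e1 skewS SS sc j cT.
Qed.

Theorem theorem5p4 (R : realType) (M : manifold R) (E : bundle M)
    (g : metric E) (Theta : anchored_bracket E)
    (Theta_pre_courant : pre_courant g Theta)
    (S : 'Z_3 -> endomorphism E) (eps : 'Z_3 -> R) (i j : 'Z_3) :
  ((hypersymplectic eps g Theta S <->
      hypersymplectic eps g (deform Theta (S i)) S) /\
   (hypersymplectic eps g Theta S <->
      hypersymplectic eps g (deform Theta (transition_morphism eps S j)) S)) /\
  ((para_hypersymplectic eps g Theta S <->
      para_hypersymplectic eps g (deform Theta (S i)) S) /\
   (para_hypersymplectic eps g Theta S <->
      para_hypersymplectic eps g
        (deform Theta (transition_morphism eps S j)) S)).
Proof.
have eqv : eps 1 * eps 2 * eps 3 = -1 -> _ :=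
  @eps_hypersymplectic_deformP _ _ _ g Theta S eps i j Theta_pre_courant.
(* The para case has sign product -1 by definition, the other one as (-1)^3. *)
have hyper : (forall k, eps k = -1) -> eps 1 * eps 2 * eps 3 = -1.
  by move=> eN; rewrite !eN mulrNN mul1r mul1r.
split; split; split.
- by move=> [h eN]; split=> //; apply: (eqv (hyper eN)).1.1.
- by move=> [h eN]; split=> //; apply: (eqv (hyper eN)).1.2.
- by move=> [h eN]; split=> //; apply: (eqv (hyper eN)).2.1.
- by move=> [h eN]; split=> //; apply: (eqv (hyper eN)).2.2.
- by move=> [h e eN]; split=> //; apply: (eqv e).1.1.
- by move=> [h e eN]; split=> //; apply: (eqv e).1.2.
- by move=> [h e eN]; split=> //; apply: (eqv e).2.1.
- by move=> [h e eN]; split=> //; apply: (eqv e).2.2.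
Qed.
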